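(* Let $\vec n:\mathbb{Z}^2\to\mathbb{R}^M$ together with $F^*:\mathbb{Z}^2\to\mathbb{R}$ be a solution of the discrete Bianchi system $$\vec n_{(12)}+\vec n=F^*_{(1)}\vec n_{(1)}+F^*_{(2)}\vec n_{(2)},\qquad \vec n\cdot\vec n\,F^*=U_1+U_2,$$ where $U_1=U_1(m_1)$, $U_2=U_2(m_2)$ are given functions of single variables, and let $\lambda$ be a real constant. Let $\Theta=(\theta,\theta',\theta'',y^1,\dots,y^{M-1})^T$ be a solution of the linear system $\Theta_{(i)}=M_i\Theta$, $i=1,2$, with the matrices $M_1,M_2$ given in the context, subject to the (admissible) constraint $I=0$, where $$I=(y^1)^2+\dots+(y^{M-1})^2+\frac{R}{F^*}\theta^2+\frac{F^*}{R}\left(b\theta''-a\theta'\right)^2-2\theta\left(a\theta'+b\theta''\right),$$ and let $\vec\omega=\sum_{A=0}^{M-1}y^A\vec\eta_A$ with $y^0=\frac{a\theta'-b\theta''}{R}$. Then 1. $\vec\omega$ satisfies $$\vec\omega\cdot\vec n=\theta_{(1)}(U_1+\lambda)-\theta_{(2)}(U_2-\lambda),$$ $$\vec\omega\cdot\vec\omega=2\left((U_1+\lambda)\theta\theta_{(1)}+(U_2-\lambda)\theta\theta_{(2)}\right)-\theta^2\,\frac{U_1+U_2}{F^*};$$ 2. the function $$\vec n'=\frac12\left[\left(\frac1{\theta_{(1)}}-\frac1{\theta_{(2)}}\right)\theta\,\vec n+\left(\frac1{\theta_{(1)}}+\frac1{\theta_{(2)}}\right)\vec\omega\right]$$ is a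 new solution of the discrete Bianchi system, i.e. there is a function $F^{*\prime}:\mathbb{Z}^2\to\mathbb{R}$ such that $\vec n'_{(12)}+\vec n'=F^{*\prime}_{(1)}\vec n'_{(1)}+F^{*\prime}_{(2)}\vec n'_{(2)}$ and $\vec n'\cdot\vec n'\,F^{*\prime}=U_1+U_2$.
   Context: Notation. For a function $f$ on $\mathbb{Z}^2$, subscripts in brackets denote shifts: $f_{(1)}(m_1,m_2)=f(m_1+1,m_2)$, $f_{(2)}(m_1,m_2)=f(m_1,m_2+1)$, $f_{(12)}(m_1,m_2)=f(m_1+1,m_2+1)$. $M\ge 3$, and ''$\cdot$'' is the Euclidean scalar product of $\mathbb{R}^M$. All quantities appearing in denominators (such as $F^*$, $R$, $a$, $b$, $\theta$) are assumed nonvanishing, and $\vec n\neq 0$. Put $R=U_1+U_2$, $a=U_1+\lambda$, $b=U_2-\lambda$. Let $\vec\eta_0=F^*\vec n$, and at each point of $\mathbb{Z}^2$ supplement $\vec\eta_0$ by unit vectors $\vec\eta_A$, $A=1,\dots,M-1$, to an orthogonal basis of $\mathbb{R}^M$. Functions $p^B_A,q^B_A$, $A,B=0,\dots,M-1$, are defined by the unique decompositions $\vec\eta_A=\sum_{B=0}^{M-1}p^B_A\,\vec\eta_{B(1)}$ and $\vec\eta_A=\sum_{B=0}^{M-1}q^B_A\,\vec\eta_{B(2)}$. The linear system $\Theta_{(1)}=M_1\Theta$ reads, written by rows ($k=1,\dots,M-1$): $$\theta_{(1)}=\theta',$$ $$\theta'_{(1)}=\frac{R_{(1)}\frac{p^0_0}{F^*}-b}{a_{(1)}}\,\theta+\frac{bF^*-R_{(1)}\left(\frac{R+b}{R}p^0_0-\frac1{F^*_{(1)}}\right)}{a_{(1)}}\,\theta'+\frac{b}{a_{(1)}}F^*\theta''-\frac{b}{a_{(1)}}\frac{R_{(1)}}{R}p^0_0\,\theta''+\frac{R_{(1)}}{a_{(1)}}\sum_{A=1}^{M-1}p^0_A\,y^A,$$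 $$\theta''_{(1)}=-\theta+F^*\theta'+F^*\theta'',$$ $$y^k_{(1)}=\frac{p^k_0}{F^*}\theta-\frac{R+b}{R}p^k_0\,\theta'-\frac bR p^k_0\,\theta''+\sum_{A=1}^{M-1}p^k_A\,y^A.$$ The linear system $\Theta_{(2)}=M_2\Theta$ reads ($k=1,\dots,M-1$): $$\theta_{(2)}=\theta'',$$ $$\theta'_{(2)}=-\theta+F^*\theta'+F^*\theta'',$$ $$\theta''_{(2)}=\frac{R_{(2)}\frac{q^0_0}{F^*}-a}{b_{(2)}}\,\theta+\frac{a}{b_{(2)}}\left(F^*-\frac{R_{(2)}}{R}q^0_0\right)\theta'+\frac{aF^*-R_{(2)}\left(\frac{R+a}{R}q^0_0-\frac1{F^*_{(2)}}\right)}{b_{(2)}}\,\theta''-\frac{R_{(2)}}{b_{(2)}}\sum_{A=1}^{M-1}q^0_A\,y^A,$$ $$y^k_{(2)}=-\frac{q^k_0}{F^*}\theta+\frac aR q^k_0\,\theta'+\frac{a+R}{R}q^k_0\,\theta''+\sum_{A=1}^{M-1}q^k_A\,y^A.$$ *)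

(* Defs.v *)
From HB Require Import structures.
From mathcomp Require Import all_boot all_order all_algebra.
From mathcomp Require Import reals.

Set Implicit Arguments.
Unset Strict Implicit.
Unset Printing Implicit Defensive.

Import Order.TTheory GRing.Theory Num.Theory.
Local Open Scope ring_scope.

(* The dimension M of the Euclidean space is written d.+1.  The index range
   A = 0, ..., M-1 is 'I_d.+1, and k = 1, ..., M-1 is represented by k : 'I_d
   through [lift ord0 k]; thus [y k] below stands for y^(k+1). *)

Definition lattice : Type := (int * int)%type.

(* f_(1) and f_(2) are [f \o s1] and [f \o s2]. *)
Definition s1 (m : lattice) : lattice := (m.1 + 1, m.2).
Definition s2 (m : lattice) : lattice := (m.1, m.2 + 1).

Definition dot (R : realType) (n : nat) (u v : 'rV[R]_n) : R :=
  \sum_(i < n) u 0 i * v 0 i.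

Definition fR (R : realType) (U1 U2 : int -> R) (m : lattice) : R :=
  U1 m.1 + U2 m.2.
Definition fa (R : realType) (U1 : int -> R) (lambda : R) (m : lattice) : R :=
  U1 m.1 + lambda.
Definition fb (R : realType) (U2 : int -> R) (lambda : R) (m : lattice) : R :=
  U2 m.2 - lambda.

Definition bianchi_solution (R : realType) (d : nat) (U1 U2 : int -> R)
    (n : lattice -> 'rV[R]_d.+1) (F : lattice -> R) : Prop :=
  (forall m, n (s2 (s1 m)) + n m =
             F (s1 m) *: n (s1 m) + F (s2 m) *: n (s2 m)) /\
  (forall m, dot (n m) (n m) * F m = U1 m.1 + U2 m.2).

Definition orthogonal_basis (R : realType) (d : nat)
    (e : 'I_d.+1 -> 'rV[R]_d.+1) : Prop :=
  basis_of fullv [seq e A | A <- enum 'I_d.+1] /\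
  (forall A B, A != B -> dot (e A) (e B) = 0).

Definition supplemented_basis (R : realType) (d : nat)
    (n : lattice -> 'rV[R]_d.+1) (F : lattice -> R)
    (eta : 'I_d.+1 -> lattice -> 'rV[R]_d.+1) : Prop :=
  forall m, [/\ eta ord0 m = F m *: n m,
                forall k : 'I_d,
                  dot (eta (lift ord0 k) m) (eta (lift ord0 k) m) = 1
              & orthogonal_basis (fun A => eta A m)].

(* [c B A] is the coefficient with upper index B and lower index A of the
   frame eta_A with respect to its translate by s. *)
Definition frame_coefficients (R : realType) (d : nat)
    (s : lattice -> lattice) (eta : 'I_d.+1 -> lattice -> 'rV[R]_d.+1)
    (c : 'I_d.+1 -> 'I_d.+1 -> lattice -> R) : Prop :=
  forall A m, eta A m = \sum_(B < d.+1) c B A m *: eta B (s m).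

(* For Theta = (th, th', th'', y^1, ..., y^(M-1))^T, the clauses of
   [linear_system1] and [linear_system2] are the rows of Theta_(1) = M_1 Theta
   and Theta_(2) = M_2 Theta, in this order. *)
Definition linear_system1 (R : realType) (d : nat) (U1 U2 : int -> R)
    (lambda : R) (F : lattice -> R) (p : 'I_d.+1 -> 'I_d.+1 -> lattice -> R)
    (th th' th'' : lattice -> R) (y : 'I_d -> lattice -> R) : Prop :=
  let r := fR U1 U2 in let a := fa U1 lambda in let b := fb U2 lambda in
  forall m,
  [/\ th (s1 m) = th' m,
      th' (s1 m) =
        (r (s1 m) * (p ord0 ord0 m / F m) - b m) / a (s1 m) * th m
        + (b m * F m
           - r (s1 m) * ((r m + b m) / r m * p ord0 ord0 m - 1 / F (s1 m)))
          / a (s1 m) * th' m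
        + b m / a (s1 m) * F m * th'' m
        - b m / a (s1 m) * (r (s1 m) / r m) * p ord0 ord0 m * th'' m
        + r (s1 m) / a (s1 m) * \sum_(A < d) p ord0 (lift ord0 A) m * y A m,
      th'' (s1 m) = - th m + F m * th' m + F m * th'' m
    & forall k : 'I_d,
      y k (s1 m) =
        p (lift ord0 k) ord0 m / F m * th m
        - (r m + b m) / r m * p (lift ord0 k) ord0 m * th' m
        - b m / r m * p (lift ord0 k) ord0 m * th'' m
        + \sum_(A < d) p (lift ord0 k) (lift ord0 A) m * y A m].

Definition linear_system2 (R : realType) (d : nat) (U1 U2 : int -> R)
    (lambda : R) (F : lattice -> R) (q : 'I_d.+1 -> 'I_d.+1 -> lattice -> R)
    (th th' th'' : lattice -> R) (y : 'I_d -> lattice -> R) : Prop :=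
  let r := fR U1 U2 in let a := fa U1 lambda in let b := fb U2 lambda in
  forall m,
  [/\ th (s2 m) = th'' m,
      th' (s2 m) = - th m + F m * th' m + F m * th'' m,
      th'' (s2 m) =
        (r (s2 m) * (q ord0 ord0 m / F m) - a m) / b (s2 m) * th m
        + a m / b (s2 m) * (F m - r (s2 m) / r m * q ord0 ord0 m) * th' m
        + (a m * F m
           - r (s2 m) * ((r m + a m) / r m * q ord0 ord0 m - 1 / F (s2 m)))
          / b (s2 m) * th'' m
        - r (s2 m) / b (s2 m) * \sum_(A < d) q ord0 (lift ord0 A) m * y A m
    & forall k : 'I_d,
      y k (s2 m) =
        - (q (lift ord0 k) ord0 m / F m) * th m
        + a m / r m * q (lift ord0 k) ord0 m * th' m
        + (a m + r m) / r m * q (lift ord0 k) ord0 m * th'' m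
        + \sum_(A < d) q (lift ord0 k) (lift ord0 A) m * y A m].

Definition constraint_I (R : realType) (d : nat) (U1 U2 : int -> R)
    (lambda : R) (F : lattice -> R)
    (th th' th'' : lattice -> R) (y : 'I_d -> lattice -> R)
    (m : lattice) : R :=
  let r := fR U1 U2 in let a := fa U1 lambda in let b := fb U2 lambda in
  \sum_(k < d) y k m ^+ 2
  + r m / F m * th m ^+ 2
  + F m / r m * (b m * th'' m - a m * th' m) ^+ 2
  - 2 * th m * (a m * th' m + b m * th'' m).

Definition omega (R : realType) (d : nat) (U1 U2 : int -> R) (lambda : R)
    (eta : 'I_d.+1 -> lattice -> 'rV[R]_d.+1)
    (th' th'' : lattice -> R) (y : 'I_d -> lattice -> R)
    (m : lattice) : 'rV[R]_d.+1 :=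
  let y0 := (fa U1 lambda m * th' m - fb U2 lambda m * th'' m) / fR U1 U2 m in
  y0 *: eta ord0 m + \sum_(k < d) y k m *: eta (lift ord0 k) m.

Definition transformed (R : realType) (d : nat)
    (n w : lattice -> 'rV[R]_d.+1) (th : lattice -> R)
    (m : lattice) : 'rV[R]_d.+1 :=
  (1 / 2) *: ((((1 / th (s1 m) - 1 / th (s2 m)) * th m) *: n m)
              + ((1 / th (s1 m) + 1 / th (s2 m)) *: w m)).

(* Main.v *)
Require Import Defs.
From HB Require Import structures.
From mathcomp Require Import all_boot all_order all_algebra.
From mathcomp Require Import reals ring.

Set Implicit Arguments.
Unset Strict Implicit.
Unset Printing Implicit Defensive.

Import Order.TTheory GRing.Theory Num.Theory.
Local Open Scope ring_scope.

(* Write th1, th2, th12 for shifts of th.  The linear system says that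
   th + th12 = F (th1 + th2) and, since a + b = R, that
     w_(1) = w + (th - 2 F th1) n + th1 n_(1),
     w_(2) = w - (th - 2 F th2) n - th2 n_(2),
   while I = 0 is the formula for w.w.  Hence n'.n' = R th th12 / (F th1 th2),
   so F' = F th1 th2 / (th th12), and the new Bianchi equation follows by
   comparing the coefficients of 1 / th112 and 1 / th122. *)

(** * The Euclidean scalar product and expansions along orthogonal families *)

Section Dot.
Variables (R : realType) (n : nat).
Implicit Types (u v w : 'rV[R]_n) (c : R).

Lemma dotC u v : dot u v = dot v u.
Proof. by apply: eq_bigr => i _; rewrite mulrC. Qed.

Lemma dotDl u v w : dot (u + v) w = dot u w + dot v w.
Proof. by rewrite -big_split; apply: eq_bigr => i _; rewrite mxE mulrDl. Qed.

Lemma dotZl c u v : dot (c *: u) v = c * dot u v.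
Proof. by rewrite [RHS]mulr_sumr; apply: eq_bigr => i _; rewrite mxE mulrA. Qed.

Lemma dotDr u v w : dot u (v + w) = dot u v + dot u w.
Proof. by rewrite dotC dotDl !(dotC u). Qed.

Lemma dotZr c u v : dot u (c *: v) = c * dot u v.
Proof. by rewrite dotC dotZl dotC. Qed.

Lemma dot_suml (I : finType) (f : I -> 'rV[R]_n) v :
  dot (\sum_i f i) v = \sum_i dot (f i) v.
Proof.
rewrite exchange_big; apply: eq_bigr => j _.
by rewrite summxE mulr_suml.
Qed.

Lemma dot_orthogonal_sum (I : finType) (e : I -> 'rV[R]_n) (c : I -> R) :
    (forall i j, i != j -> dot (e i) (e j) = 0) ->
  forall i, dot (\sum_j c j *: e j) (e i) = c i * dot (e i) (e i).
Proof.
move=> e_orth i; rewrite dot_suml (bigD1 i) //= dotZl big1 ?addr0 // => j ji.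
by rewrite dotZl e_orth // mulr0.
Qed.

Lemma dot_orthogonal_sum_self (I : finType) (e : I -> 'rV[R]_n) (c : I -> R) :
    (forall i j, i != j -> dot (e i) (e j) = 0) ->
  dot (\sum_j c j *: e j) (\sum_j c j *: e j)
  = \sum_j c j ^+ 2 * dot (e j) (e j).
Proof.
move=> e_orth; rewrite {1}dot_suml; apply: eq_bigr => j _.
by rewrite dotZl dotC dot_orthogonal_sum // mulrA expr2.
Qed.

End Dot.

(** * Scalar products and lattice shifts of [omega] in the moving frame [eta] *)

Section Frame.
Variables (R : realType) (d : nat) (U1 U2 : int -> R) (lambda : R).
Variables (n : lattice -> 'rV[R]_d.+1) (F : lattice -> R).
Variables (eta : 'I_d.+1 -> lattice -> 'rV[R]_d.+1).
Variables (th th' th'' : lattice -> R) (y : 'I_d -> lattice -> R).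
Hypothesis hB : bianchi_solution U1 U2 n F.
Hypothesis heta : supplemented_basis n F eta.
Hypothesis hF0 : forall m, F m != 0.
Hypothesis hR0 : forall m, fR U1 U2 m != 0.

Let r := fR U1 U2.
Let a := fa U1 lambda.
Let b := fb U2 lambda.
Let w := omega U1 U2 lambda eta th' th'' y.

(** The exceptional coordinate y^0 and the remaining [y k] form one family over ['I_d.+1], so that
    the frame coefficients act on all of them by a single matrix sum. *)
Definition omega_coord (A : 'I_d.+1) (m : lattice) : R :=
  oapp (y ^~ m) ((a m * th' m - b m * th'' m) / r m) (unlift ord0 A).

Lemma omega_coord0 m :
  omega_coord ord0 m = (a m * th' m - b m * th'' m) / r m.
Proof. by rewrite /omega_coord unlift_none. Qed.

Lemma omega_coord_lift k m : omega_coord (lift ord0 k) m = y k m.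
Proof. by rewrite /omega_coord liftK. Qed.

Lemma omegaE m : w m = \sum_A omega_coord A m *: eta A m.
Proof.
rewrite big_ord_recl omega_coord0; congr (_ + _).
by apply: eq_bigr => k _; rewrite omega_coord_lift.
Qed.

Lemma fRE m : r m = a m + b m.
Proof. by rewrite /r /a /b /fR /fa /fb; ring. Qed.

Lemma eta_orthogonal m A B : A != B -> dot (eta A m) (eta B m) = 0.
Proof. by have [_ _ []] := heta m; move=> _; apply. Qed.

Lemma eta0_shift m : eta ord0 m = F m *: n m.
Proof. by have [] := heta m. Qed.

Lemma dot_eta0 m : dot (eta ord0 m) (eta ord0 m) = F m * r m.
Proof.
by rewrite eta0_shift dotZl dotZr [r m]/fR -(hB.2 m) (mulrC (dot _ _)).
Qed.

(** Since [n] is parallel to [eta ord0], orthogonality leaves only the coordinate y^0, and its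
    denominator [r] cancels against [dot_eta0]. *)
Lemma dot_omega_n m : dot (w m) (n m) = a m * th' m - b m * th'' m.
Proof.
apply: (mulfI (hF0 m)); rewrite -dotZr -eta0_shift omegaE.
rewrite (dot_orthogonal_sum _ (@eta_orthogonal m)) dot_eta0 omega_coord0.
by field; exact: hR0.
Qed.

(** By orthogonality [dot (w m) (w m)] is the sum of the squares [y k m ^+ 2] plus the [F / r] term
    of the constraint. The difference of the two sides is therefore exactly I. *)
Lemma dot_omega m :
    constraint_I U1 U2 lambda F th th' th'' y m = 0 ->
  dot (w m) (w m)
  = 2 * (a m * th m * th' m + b m * th m * th'' m) - th m ^+ 2 * (r m / F m).
Proof.
rewrite /constraint_I -/r -/a -/b => hI.
rewrite omegaE (dot_orthogonal_sum_self _ (@eta_orthogonal m)).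
rewrite big_ord_recl dot_eta0 omega_coord0.
rewrite (eq_bigr (fun k => y k m ^+ 2)); last first.
  by move=> k _; rewrite omega_coord_lift; have [_ -> _] := heta m; rewrite mulr1.
set S := \sum_k _ in hI *.
apply/eqP; rewrite -subr_eq0 -[X in _ == X]hI; apply/eqP; field.
by rewrite hF0 hR0.
Qed.

Lemma frame_shift s c g m : frame_coefficients s eta c ->
  \sum_B (\sum_A c B A m * g A) *: eta B (s m) = \sum_A g A *: eta A m.
Proof.
move=> hc; under eq_bigr do rewrite scaler_suml.
rewrite exchange_big; apply: eq_bigr => A _.
rewrite (hc A m) scaler_sumr; apply: eq_bigr => B _.
by rewrite scalerA mulrC.
Qed.

(** Common pattern of both linear systems: the coordinates are carried by [c], up to a multiple [u]
    of its column 0 and a correction [v] in direction 0. Column 0 resums to [eta ord0 m], that is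
    [F m *: n m], and the correction contributes along [n (s m)]. *)
Lemma omega_frame_shift s c u v m : frame_coefficients s eta c ->
    (forall B, omega_coord B (s m) = \sum_A c B A m * omega_coord A m
       + c B ord0 m * u + (B == ord0)%:R * v) ->
  w (s m) = w m + (u * F m) *: n m + (v * F (s m)) *: n (s m).
Proof.
move=> hc hw; rewrite !omegaE -2!scalerA -!eta0_shift.
under eq_bigr => B _ do rewrite hw !scalerDl.
rewrite !big_split /= (frame_shift _ _ hc); congr (_ + _ + _).
  rewrite (hc ord0 m) scaler_sumr; apply: eq_bigr => B _.
  by rewrite scalerA mulrC.
rewrite (bigD1 ord0) //= mul1r big1 ?addr0 // => B /negPf->.
by rewrite mul0r scale0r.
Qed.

Hypothesis ha0 : forall m, a m != 0.
Hypothesis hb0 : forall m, b m != 0.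

Lemma omega_shift1 p m : frame_coefficients s1 eta p ->
    linear_system1 U1 U2 lambda F p th th' th'' y ->
  w (s1 m) = w m + (th m - 2 * F m * th (s1 m)) *: n m
             + th (s1 m) *: n (s1 m).
Proof.
move=> hp h1; have [e0 e1 e2 ek] := h1 m; rewrite e0.
(* [u] is the coefficient of p^k_0 in the row of y^k minus y^0: the [th''] terms cancel and (R + b +
   a) / R = 2. [v] comes from the term 1 / F*_(1) in the row of [th']. *)
rewrite (omega_frame_shift (u := th m / F m - 2 * th' m)
  (v := th' m / F (s1 m)) hp).
  congr (_ + _ *: _ + _ *: _); first by field; exact: hF0.
  by rewrite divfK.
(* [U2] depends on the second variable only, so [b] is invariant under [s1]. *)
have bs : b (s1 m) = b m by [].
have r0 := hR0 m; have rs0 := hR0 (s1 m); have as0 := ha0 (s1 m).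
rewrite -/r fRE in r0; rewrite -/r fRE bs in rs0.
move=> B; rewrite big_ord_recl omega_coord0.
under eq_bigr => A _ do rewrite omega_coord_lift.
case: (unliftP ord0 B) => [k ->|->].
  rewrite omega_coord_lift ek -/r -/b fRE mulr0n; set S := \sum_k0 _.
  by field; rewrite !hF0 r0.
rewrite omega_coord0 e1 e2 -/r -/a -/b !fRE bs eqxx mulr1n.
set S := \sum_k0 _.
by field; rewrite !hF0 r0 rs0 as0.
Qed.

(** Mirror image of [omega_shift1]: exchanging the two directions swaps [a] with [b] and [th'] with
    [th''], and reverses the sign of every coordinate of [w]. *)
Lemma omega_shift2 q m : frame_coefficients s2 eta q ->
    linear_system2 U1 U2 lambda F q th th' th'' y ->
  w (s2 m) = w m - (th m - 2 * F m * th (s2 m)) *: n m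
             - th (s2 m) *: n (s2 m).
Proof.
move=> hq h2; have [e0 e1 e2 ek] := h2 m; rewrite e0 -!scaleNr.
rewrite (omega_frame_shift (u := - (th m / F m) + 2 * th'' m)
  (v := - (th'' m / F (s2 m))) hq).
  congr (_ + _ *: _ + _ *: _); first by field; exact: hF0.
  by rewrite mulNr divfK.
have as_ : a (s2 m) = a m by [].
have r0 := hR0 m; have rs0 := hR0 (s2 m); have bs0 := hb0 (s2 m).
rewrite -/r fRE in r0; rewrite -/r fRE as_ in rs0.
move=> B; rewrite big_ord_recl omega_coord0.
under eq_bigr => A _ do rewrite omega_coord_lift.
case: (unliftP ord0 B) => [k ->|->].
  rewrite omega_coord_lift ek -/r -/a fRE mulr0n; set S := \sum_k0 _.
  by field; rewrite !hF0 r0.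
rewrite omega_coord0 e1 e2 -/r -/a -/b !fRE as_ eqxx mulr1n.
set S := \sum_k0 _.
by field; rewrite !hF0 r0 rs0 bs0.
Qed.

End Frame.

(** The potential of the discrete Moutard transformation generated by [th]: with it, 1 / [th]
    satisfies the same kind of equation as [th] does with [F]. *)
Definition transformed_F (R : realType) (F th : lattice -> R)
    (m : lattice) : R :=
  F m * th (s1 m) * th (s2 m) / (th m * th (s2 (s1 m))).

(** * The transformed Bianchi equation and its norm condition *)

Section Transformation.
Variables (R : realType) (d : nat) (F th : lattice -> R).
Variables (n w : lattice -> 'rV[R]_d.+1).
Hypothesis hF0 : forall m, F m != 0.
Hypothesis hth0 : forall m, th m != 0.
Hypothesis th_moutard :
  forall m, th (s2 (s1 m)) + th m = F m * (th (s1 m) + th (s2 m)).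

Lemma transformed_bianchi m :
    (forall m, w (s1 m) = w m + (th m - 2 * F m * th (s1 m)) *: n m
                          + th (s1 m) *: n (s1 m)) ->
    (forall m, w (s2 m) = w m - (th m - 2 * F m * th (s2 m)) *: n m
                          - th (s2 m) *: n (s2 m)) ->
  let n' := transformed n w th in let F' := transformed_F F th in
  n' (s2 (s1 m)) + n' m = F' (s1 m) *: n' (s1 m) + F' (s2 m) *: n' (s2 m).
Proof.
move=> w1 w2 n' F'.
(* The Moutard equation at [s1 m] eliminates [th (s1 (s1 m))], which makes the coefficients affine
   in 1 / th112. *)
have F1n1 : F' (s1 m) *: n' (s1 m) = (1 / 2) *:
    ((2 * F (s1 m) * th (s2 (s1 m)) / th (s2 (s1 (s1 m))) - 1
      - th (s1 m) / th (s2 (s1 (s1 m)))) *: n (s1 m)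
     + (1 / th (s1 m) + 1 / th (s2 (s1 (s1 m)))) *: w (s1 m)).
  have := th_moutard (s1 m); have t0 := hth0 (s2 (s1 (s1 m))) => e.
  have {}e : th (s2 (s1 (s1 m))) =
    F (s1 m) * (th (s1 (s1 m)) + th (s2 (s1 m))) - th (s1 m) by rewrite -e addrK.
  apply/rowP => j; rewrite !mxE /F' /transformed_F e.
  by field; rewrite -e t0 !hth0.
have F2n2 : F' (s2 m) *: n' (s2 m) = (1 / 2) *:
    ((1 + th (s2 m) / th (s2 (s1 (s2 m)))
      - 2 * F (s2 m) * th (s2 (s1 m)) / th (s2 (s1 (s2 m)))) *: n (s2 m)
     + (1 / th (s2 m) + 1 / th (s2 (s1 (s2 m)))) *: w (s2 m)).
  have := th_moutard (s2 m); have t0 := hth0 (s2 (s1 (s2 m))) => e.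
  have {}e : th (s2 (s1 (s2 m))) =
    F (s2 m) * (th (s2 (s1 m)) + th (s2 (s2 m))) - th (s2 m) by rewrite -e addrK.
  apply/rowP => j; rewrite !mxE /F' /transformed_F -[s1 (s2 m)]/(s2 (s1 m)) e.
  by field; rewrite -e t0 !hth0.
(* The two combinations of [n] and [w] at the far corner that multiply 1 / th112 and 1 / th122 in
   [n12] are expressed by data at [s1 m] and at [s2 m] respectively. *)
have e12 : th (s2 (s1 m)) *: n (s2 (s1 m)) + w (s2 (s1 m)) =
    w (s1 m) - (th (s1 m) - 2 * F (s1 m) * th (s2 (s1 m))) *: n (s1 m).
  by rewrite (w2 (s1 m)) addrC subrK.
have e21 : w (s2 (s1 m)) - th (s2 (s1 m)) *: n (s2 (s1 m)) =
    w (s2 m) + (th (s2 m) - 2 * F (s2 m) * th (s2 (s1 m))) *: n (s2 m).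
  by rewrite -[s2 (s1 m)]/(s1 (s2 m)) (w1 (s2 m)) addrK.
have n12 : n' (s2 (s1 m)) = (1 / 2) *:
    ((1 / th (s2 (s1 (s1 m)))) *:
       (th (s2 (s1 m)) *: n (s2 (s1 m)) + w (s2 (s1 m)))
     + (1 / th (s2 (s1 (s2 m)))) *:
       (w (s2 (s1 m)) - th (s2 (s1 m)) *: n (s2 (s1 m)))).
  apply/rowP => j; rewrite !mxE.
  rewrite -[s1 (s2 (s1 m))]/(s2 (s1 (s1 m))) -[s2 (s2 (s1 m))]/(s2 (s1 (s2 m))).
  by field; rewrite !hth0.
(* The terms in 1 / th112 and 1 / th122 now agree. In the rest, the multiples of [n (s1 m)], of
   [n (s2 m)] and of [2 * F m] cancel, leaving [n' m]. *)
rewrite F1n1 F2n2 n12 e12 e21 (w1 m) (w2 m); apply/rowP => j.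
by rewrite !mxE; field; rewrite !hth0.
Qed.

(** On expansion [a] and [b] enter only through their sum [r], and the factor th1 + th2 - th / F
    equals th12 / F by the Moutard equation. *)
Lemma transformed_norm m r a b :
    a + b = r -> dot (n m) (n m) * F m = r ->
    dot (w m) (n m) = a * th (s1 m) - b * th (s2 m) ->
    dot (w m) (w m) = 2 * (a * th m * th (s1 m) + b * th m * th (s2 m))
                      - th m ^+ 2 * (r / F m) ->
  dot (transformed n w th m) (transformed n w th m) * transformed_F F th m = r.
Proof.
move=> abr nn wn ww; have {}nn : dot (n m) (n m) = r / F m by rewrite -nn mulfK.
have t0 := hth0 (s2 (s1 m)).
have e : th (s2 (s1 m)) = F m * (th (s1 m) + th (s2 m)) - th m.
  by rewrite -th_moutard addrK.
rewrite /transformed dotZl dotZr !dotDl !dotDr !dotZl !dotZr.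
rewrite (dotC (n m) (w m)) nn wn ww -abr /transformed_F e.
by field; rewrite -e t0 !hth0 hF0.
Qed.

End Transformation.

Theorem proposition17 (R : realType) (d : nat) (hM : (3 <= d.+1)%N)
  (U1 U2 : int -> R) (lambda : R)
  (n : lattice -> 'rV[R]_d.+1) (F : lattice -> R)
  (hB : bianchi_solution U1 U2 n F)
  (eta : 'I_d.+1 -> lattice -> 'rV[R]_d.+1)
  (heta : supplemented_basis n F eta)
  (p q : 'I_d.+1 -> 'I_d.+1 -> lattice -> R)
  (hp : frame_coefficients s1 eta p)
  (hq : frame_coefficients s2 eta q)
  (th th' th'' : lattice -> R) (y : 'I_d -> lattice -> R)
  (hn0 : forall m, n m != 0)
  (hF0 : forall m, F m != 0)
  (hR0 : forall m, fR U1 U2 m != 0)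
  (ha0 : forall m, fa U1 lambda m != 0)
  (hb0 : forall m, fb U2 lambda m != 0)
  (hth0 : forall m, th m != 0)
  (h1 : linear_system1 U1 U2 lambda F p th th' th'' y)
  (h2 : linear_system2 U1 U2 lambda F q th th' th'' y)
  (hI : forall m, constraint_I U1 U2 lambda F th th' th'' y m = 0) :
  let w := omega U1 U2 lambda eta th' th'' y in
  (forall m : lattice,
     dot (w m) (n m) =
       th (s1 m) * (U1 m.1 + lambda) - th (s2 m) * (U2 m.2 - lambda) /\
     dot (w m) (w m) =
       2 * ((U1 m.1 + lambda) * th m * th (s1 m)
            + (U2 m.2 - lambda) * th m * th (s2 m))
       - th m ^+ 2 * ((U1 m.1 + U2 m.2) / F m)) /\
  (exists F' : lattice -> R,
     bianchi_solution U1 U2 (transformed n w th) F').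
Proof.
move=> w.
have wn m : dot (w m) (n m) =
    fa U1 lambda m * th (s1 m) - fb U2 lambda m * th (s2 m).
  have [-> _ _ _] := h1 m; have [-> _ _ _] := h2 m.
  exact: dot_omega_n hB heta hF0 hR0 m.
have ww m : dot (w m) (w m) =
    2 * (fa U1 lambda m * th m * th (s1 m) + fb U2 lambda m * th m * th (s2 m))
    - th m ^+ 2 * (fR U1 U2 m / F m).
  have [-> _ _ _] := h1 m; have [-> _ _ _] := h2 m.
  exact: dot_omega hB heta hF0 hR0 m (hI m).
(* As [th''] is [th] shifted by [s2], the row of [th''] in the first system is the Moutard
   equation. *)
have moutard m : th (s2 (s1 m)) + th m = F m * (th (s1 m) + th (s2 m)).
  have [e1 _ e12 _] := h1 m; have [e2 _ _ _] := h2 m.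
  have [-> _ _ _] := h2 (s1 m).
  by rewrite e12 e1 e2; ring.
split=> [m|].
  by split; [rewrite wn ![_ * th _]mulrC | exact: ww].
exists (transformed_F F th); split=> m.
  have w1 k := omega_shift1 heta hF0 hR0 ha0 k hp h1.
  have w2 k := omega_shift2 heta hF0 hR0 hb0 k hq h2.
  exact: transformed_bianchi hth0 moutard m w1 w2.
apply: (transformed_norm hF0 hth0 moutard (esym (fRE _ _ _ m)) _ (wn m) (ww m)).
exact: hB.2.
Qed.
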